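(* Let $k,n$ be integers with $3\le k\le n$. Suppose a stick is broken at random at $n-1$ points to form $n$ pieces, and then $k$ of the $n$ pieces are chosen at random, all $\binom{n}{k}$ choices being equally probable. Let $P_{\mathrm{rand}}(k,n)$ be the probability that the $k$ pieces so chosen do not form a $k$-gon. Then $$P_{\mathrm{rand}}(k,n)=P(k,k),$$ where $P(k,k)$ is the probability that the $k$ pieces obtained when a stick is broken at random at $k-1$ points do not form a $k$-gon.
   Context: The stick is taken, without loss of generality, to have length 1. ''Broken at random at $m-1$ points'' means that the $m-1$ breaking points are independent and uniformly distributed on the stick; the $m$ pieces are the resulting consecutive segments. The random choice of the $k$ pieces is made independently of the lengths of the pieces. A set of $k$ pieces forms a $k$-gon if and only if the length of the longest of these pieces is less than the sum of the lengths of the other $k-1$ pieces (ties occur with probability zero). *)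

(* Defs.v *)
From mathcomp Require Export all_boot all_order all_algebra.
From mathcomp Require Export all_classical all_reals all_analysis.

Set Implicit Arguments.
Unset Strict Implicit.
Unset Printing Implicit Defensive.

Import Order.TTheory GRing.Theory Num.Theory.

Local Open Scope classical_set_scope.
Local Open Scope ring_scope.

(* The stick is [0, 1]; breaking it at the m points x yields m.+1 pieces, listed
   from left to right. *)
Definition pieces (R : realType) (m : nat) (x : 'I_m -> R) : seq R :=
  pairmap (fun a b => b - a) 0 (rcons (sort <=%R (codom x)) 1).

(* Length of the i-th piece, counted from 0. *)
Definition piece (R : realType) (m : nat) (x : 'I_m -> R) (i : nat) : R :=
  nth 0 (pieces x) i.

(* The pieces with index in A, the i-th one having length l i, form a polygon
   with #|A| sides.  If several j attain the maximal length, all of them give the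
   same comparison. *)
Definition forms_polygon (R : realType) (n : nat) (l : 'I_n -> R)
    (A : {set 'I_n}) : bool :=
  [exists j in A, [forall i in A, l i <= l j] &&
    (l j < \sum_(i in A :\ j) l i)].

Definition mutually_independent (d : measure_display) (T : measurableType d)
    (R : realType) (P : probability T R) (I : finType)
    (X : I -> {RV P >-> R}) : Prop :=
  forall (J : {set I}) (B : I -> set R),
    (forall i, i \in J -> measurable (B i)) ->
    P (\bigcap_(i in [set` J]) X i @^-1` B i) =
      (\prod_(i in J) P (X i @^-1` B i))%E.

Definition iid_uniform01 (d : measure_display) (T : measurableType d)
    (R : realType) (P : probability T R) (m : nat)
    (X : 'I_m -> {RV P >-> R}) : Prop :=
  mutually_independent X /\
  forall (i : 'I_m) (B : set R), measurable B ->
    distribution P (X i) B = uniform_prob (@ltr01 R) B.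

(* S is measurable for the discrete sigma-algebra on {set 'I_n} and uniformly
   distributed on the k-element subsets of 'I_n. *)
Definition uniform_ksubset (d : measure_display) (T : measurableType d)
    (R : realType) (P : probability T R) (n k : nat)
    (S : T -> {set 'I_n}) : Prop :=
  (forall A : {set 'I_n}, measurable (S @^-1` [set A])) /\
  (forall A : {set 'I_n},
     P (S @^-1` [set A]) = (if #|A| == k then 'C(n, k)%:R^-1 else 0)%:E).

(* S is independent of the sigma-algebra generated by L_0, ..., L_{n-1}. *)
Definition independent_of_family (d : measure_display) (T : measurableType d)
    (R : realType) (P : probability T R) (n : nat)
    (S : T -> {set 'I_n}) (L : 'I_n -> T -> R) : Prop :=
  forall (A : {set 'I_n}) (E : set T), g_sigma_preimage L E ->
    P (S @^-1` [set A] `&` E) = (P (S @^-1` [set A]) * P E)%E.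

(* Main.v *)
Require Import Defs.
From mathcomp Require Import perm measurable_realfun ring lra zify.

(** Since the choice of the pieces is independent of their lengths and uniform,
    it is enough to show that, for every fixed set [A] of [k] pieces, the
    probability that the pieces in [A] do not form a polygon is the probability
    for the [k] pieces of a stick broken at [k - 1] points
    ([non_polygon_law]). Only two invariance properties of the breaking points
    are used.

    The first one is circular symmetry. Gluing the two ends of the stick turns
    the [n - 1] independent points together with the junction into [n] points on
    a circle, and any of them may serve as junction. Thus cyclically shifting
    the pieces does not change their joint law ([non_polygon_rotate]), and if
    some piece is not in [A], it may be assumed to be the last one.

    The second one is scaling. Given the largest breaking point [u], the others
    are independent and uniform on [[0, u]], so the pieces but the last one are,
    up to the factor [u], the pieces of a stick broken at [n - 2] points. The
    polygon inequality is homogeneous, hence the last piece may be discarded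
    ([non_polygon_drop_last]). Repeating both steps leads to [n = k].

    Both steps condition on the value of the breaking point that has a given
    rank. As the points are exchangeable and almost surely distinct, the
    probability of a symmetric event is the number of points times its
    probability on the event that the first point has that rank
    ([uniform_cube_rank]); after this, conditioning is Fubini's theorem for one
    coordinate against the others ([uniform_cube_disintegrate]). Given the first
    coordinate, rotations and dilations act separately on each of the other
    coordinates, so that only computations with the uniform law on an interval
    remain ([U01_rotate], [U01_dilate]). *)

Set Implicit Arguments.
Unset Strict Implicit.
Unset Printing Implicit Defensive.

Import Order.TTheory GRing.Theory Num.Theory.
Import numFieldNormedType.Exports.

Local Open Scope classical_set_scope.
Local Open Scope ring_scope.

(** * The uniform law on the unit interval *)

(** The existential form gives the image measure as an abstract [measure], whose
    only visible property is its value on sets. *)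
Lemma pushforward_measureP (R : realType) d d' (T : measurableType d)
    (T' : measurableType d') (mu : {measure set T -> \bar R}) (f : T -> T') :
  measurable_fun setT f ->
  exists nu : {measure set T' -> \bar R}, forall A, nu A = mu (f @^-1` A).
Proof. by move=> mf; unshelve eexists (pushforward mu f : measure _ _). Qed.

Lemma pushforward_probabilityP (R : realType) d d' (T : measurableType d)
    (T' : measurableType d') (P : probability T R) (f : T -> T') :
  measurable_fun setT f ->
  exists Q : probability T' R, forall A, Q A = P (f @^-1` A).
Proof. by move=> mf; exists (distribution P (mfun_Sub (mem_set mf))). Qed.

Lemma measurable_preimageT d d' (T : measurableType d) (T' : measurableType d')
    (f : T -> T') (B : set T') :
  measurable_fun setT f -> measurable B -> measurable (f @^-1` B).
Proof. by move=> mf mB; rewrite -[X in measurable X]setTI; exact: mf. Qed.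

(** The law [uniform_prob] on [[0, 1]], packed with its probability structure. *)
Definition U01 (R : realType) : probability (measurableTypeR R) R :=
  uniform_prob (@ltr01 R).

Definition preserves_U01 (R : realType) (f : R -> R) : Prop :=
  measurable_fun setT f /\
  forall B : set R, measurable B -> U01 R (f @^-1` B) = U01 R B.

Lemma measurable_interval (R : realType) (a b : R) :
  measurable [set x : R | a < x < b].
Proof. by rewrite (_ : mkset _ = `]a, b[%classic). Qed.

Lemma measurable_affine (R : realType) (c e : R) :
  measurable_fun [set: R] (fun x => c * x + e).
Proof. by apply: measurable_funD => //; apply: measurable_funM. Qed.

Lemma measurable_affine_preimage (R : realType) (c e : R) (B : set R) :
  measurable B -> measurable [set x : R | B (c * x + e)].
Proof. exact: (measurable_preimageT (measurable_affine c e)). Qed.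

(** Both sides are measures in [B], so half-open intervals suffice. *)
Lemma lebesgue_affine (R : realType) (c e : R) (B : set R) : 0 < c ->
  measurable B ->
  (c%:E * lebesgue_measure [set x : R | B (c * x + e)%R] = lebesgue_measure B)%E.
Proof.
move=> c0 mB.
have [nu nuE] := pushforward_measureP (@lebesgue_measure R)
  (measurable_affine c e : measurable_fun [set: measurableTypeR R]
     (_ : _ -> measurableTypeR R)).
transitivity (mscale (NngNum (ltW c0)) nu B); first by rewrite /mscale/= nuE.
apply/esym/lebesgue_measure_unique => // _ [[a b]] _ <-.
transitivity (c%:E * nu `]a, b]%classic)%E; last by [].
rewrite nuE.
rewrite (_ : _ @^-1` _ = `](a - e) / c, (b - e) / c]%classic); last first.
  apply/seteqP; split => x /=; rewrite !in_itv/= ltr_pdivrMr// ler_pdivlMr//;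
    rewrite ltrBlDr lerBrDr (mulrC x) //.
rewrite [in LHS]lebesgue_measure_itv [X in (_ * X)%E]lebesgue_measure_itv/=.
rewrite !lte_fin ltr_pM2r ?invr_gt0// ltrD2r.
case: ifPn => // _; last by rewrite mule0.
by rewrite -EFinM -EFinB; congr EFin; field; rewrite gt_eqF.
Qed.

(** The two endpoints carry no mass; the open interval is the one on which the
    rotations and dilations below are bijective. *)
Lemma U01E (R : realType) (B : set R) : measurable B ->
  U01 R B = lebesgue_measure (B `&` `]0, 1[).
Proof.
move=> mB; transitivity (lebesgue_measure (B `&` `[0, 1])).
  rewrite /U01/= /uniform_prob integral_uniform_pdf.
  rewrite (eq_integral (fun=> 1%E)).
    by rewrite integral_cst ?mul1e//; exact: measurableI.
  move=> x; rewrite inE/= in_itv/= /uniform_pdf => -[_ ->].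
  by rewrite subr0 invr1.
have -> : `[0, 1]%classic = `]0, 1[%classic `|` ([set 0] `|` [set 1]) :> set R.
  apply/seteqP; split => x /=; rewrite !in_itv/=.
    have [->|x0] := eqVneq x 0; first by right; left.
    have [->|x1] := eqVneq x 1; first by right; right.
    by rewrite le_eqVlt eq_sym (negbTE x0)/= le_eqVlt (negbTE x1)/=; left.
  by move=> [/andP[/ltW-> /ltW->]//|[->|->]]; rewrite ?lexx ler01.
rewrite setIUr measureU0//; first exact: measurableI.
  by apply: measurableI => //; apply: measurableU.
apply: countable_lebesgue_measure0.
apply: (@sub_countable _ _ _ [set 0; 1]%classic) => //.
  exact: subset_card_le.
exact: finite_set_countable.
Qed.

Lemma U01_reflect (R : realType) : preserves_U01 (fun x : R => 1 - x).
Proof.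
have mf : measurable_fun [set: R] (fun x => 1 - x) by exact: measurable_funB.
split=> // B mB.
have mB' : measurable (B `&` `]0, 1[) by apply: measurableI.
rewrite !U01E//; last exact: measurable_preimageT.
rewrite -(@lebesgue_affine _ 1 1 (B `&` `]0, 1[))// mul1e.
rewrite -(lebesgue_measureN (measurable_affine_preimage 1 1 mB')).
congr lebesgue_measure; apply/seteqP; split => x /=;
  rewrite !in_itv/= (_ : 1 * - x + 1 = 1 - x); try ring;
  by move=> [Bx x01]; split => //; lra.
Qed.

(** The map [x |-> x - u] modulo 1 on the circle [0, 1] with its endpoints
    glued. The points outside the two open arcs cut out by [0] and [u], a
    negligible set, all go to [0]: thus a point lies in an open arc if and only
    if its image does, which turns events into events exactly and not just
    almost surely. *)
Definition rotate (R : realType) (u x : R) : R :=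
  if 0 < x < u then x - u + 1 else if u < x < 1 then x - u else 0.

(** Each open arc is translated, and Lebesgue measure is translation invariant;
    the point [u] between the arcs, and its counterpart [1 - u], are negligible. *)
Lemma U01_rotate (R : realType) (u : R) : 0 < u < 1 -> preserves_U01 (rotate u).
Proof.
move=> /andP[u0 u1].
have mr : measurable_fun setT (rotate u).
  apply: measurable_fun_ifT.
  - by apply: measurable_and; apply: measurable_fun_ltr.
  - by apply: measurable_funD => //; apply: measurable_funB.
  - apply: measurable_fun_ifT => //.
    + by apply: measurable_and; apply: measurable_fun_ltr.
    + exact: measurable_funB.
split=> // B mB.
have mo : measurable (rotate u @^-1` B) by exact: measurable_preimageT.
rewrite !U01E//.
pose B1 := B `&` `]1 - u, 1[; pose B2 := B `&` `]0, 1 - u[.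
have mB1 : measurable B1 by apply: measurableI.
have mB2 : measurable B2 by apply: measurableI.
have mA1 := measurable_affine_preimage 1 (1 - u) mB1.
have mA2 := measurable_affine_preimage 1 (- u) mB2.
have l0 (C : set R) a : lebesgue_measure (C `&` [set a]) = 0%E.
  apply: countable_lebesgue_measure0.
  apply: (@sub_countable _ _ _ [set a]) => //.
  exact: subset_card_le.
transitivity (lebesgue_measure B1 + lebesgue_measure B2)%E.
- rewrite -(@lebesgue_affine _ 1 (1 - u) B1)// -(@lebesgue_affine _ 1 (- u) B2)//.
  rewrite !mul1e -measureU//; last first.
    rewrite -subset0 => x [[_ /=]] + [_ /=].
    by rewrite !in_itv/=; lra.
  pose C1 := [set x | B1 (1 * x + (1 - u))].
  pose C2 := [set x | B2 (1 * x + - u)].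
  rewrite -[X in _ = lebesgue_measure X]/(C1 `|` C2).
  have mC := measurableU _ _ mA1 mA2.
  have -> : rotate u @^-1` B `&` `]0, 1[ =
      (C1 `|` C2) `|` ((rotate u @^-1` B) `&` [set u]).
    apply/seteqP; split => x /=.
    + rewrite in_itv/= => -[Bx x01].
      have [xu|xu|xu] := ltgtP x u.
      * left; left; move: Bx; rewrite /rotate ifT; last lra.
        rewrite /C1/= /B1/= in_itv/= => Bx.
        by rewrite (_ : 1 * x + (1 - u) = x - u + 1); [split => //; lra|lra].
      * left; right; move: Bx; rewrite /rotate ifF; last by apply/negbTE; lra.
        rewrite ifT; last lra.
        rewrite /C2/= /B2/= in_itv/= => Bx.
        by rewrite (_ : 1 * x + - u = x - u); [split => //; lra|lra].
      * by right.
    + rewrite /C1/C2/B1/B2/= => -[[[]|[]]|]; rewrite ?in_itv/=.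
      * move=> + H; rewrite (_ : 1 * x + (1 - u) = x - u + 1); last lra.
        by move=> Bx; rewrite /rotate ifT; [split => //; lra|lra].
      * move=> + H; rewrite (_ : 1 * x + - u = x - u); last lra.
        move=> Bx; rewrite /rotate ifF; last by apply/negbTE; lra.
        by rewrite ifT; [split => //; lra|lra].
      * by move=> [Bu xu]; split => //; rewrite xu; lra.
  rewrite measureU0//; [exact: measurableI|exact: l0].
- rewrite -measureU//; last first.
    rewrite -subset0 => x [[_ /=]] + [_ /=].
    by rewrite !in_itv/=; lra.
  have -> : B `&` `]0, 1[ = (B1 `|` B2) `|` (B `&` [set 1 - u]).
    apply/seteqP; split => x /=.
    + rewrite in_itv/= => -[Bx x01].
      have [xu|xu|xu] := ltgtP x (1 - u).
      * by left; right; split => //=; rewrite in_itv/=; lra.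
      * by left; left; split => //=; rewrite in_itv/=; lra.
      * by right; split => //; rewrite -?xu.
    + move=> [[[]|[]]|[]]; rewrite /= ?in_itv/= => Bx H; split => //; try lra.
  rewrite measureU0//; [exact: measurableU|exact: measurableI|exact: l0].
Qed.

(** Scale invariance of the uniform law: conditionally on [x < u], the ratio
    [x / u] is again uniform. The product form, without dividing by the
    probability of the condition, is what extends to several coordinates. *)
Lemma U01_dilate (R : realType) (u : R) (B : set R) : 0 < u < 1 -> measurable B ->
  U01 R [set x | 0 < x < u /\ B (x / u)] =
    (U01 R [set x | 0 < x < u]%R * U01 R B)%E.
Proof.
move=> /andP[u0 u1] mB.
have mI := measurable_interval 0 u.
suff H (C : set R) : measurable C ->
    U01 R [set x | 0 < x < u /\ C (x / u)] = (u%:E * U01 R C)%E.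
  rewrite H// (_ : U01 R [set x | 0 < x < u] = u%:E)//.
  rewrite -[RHS]mule1 -(probability_setT (U01 R)) -H//.
  by congr (U01 R _); apply/seteqP; split => x /=; [move=> ->|case].
move=> mC.
have mD : measurable ([set x : R | 0 < x < u] `&` [set x | C (u^-1 * x + 0)]).
  by apply: measurableI => //; exact: measurable_affine_preimage.
have -> : [set x : R | 0 < x < u /\ C (x / u)] =
  [set x : R | 0 < x < u] `&` [set x | C (u^-1 * x + 0)].
  by apply/seteqP; split => x /=; rewrite addr0 mulrC.
rewrite !U01E//.
rewrite -(@lebesgue_affine _ u^-1 0 (C `&` `]0, 1[)) ?invr_gt0//; last first.
  exact: measurableI.
rewrite muleA -EFinM divff ?gt_eqF// mul1e.
congr lebesgue_measure; apply/seteqP; split => x /=; rewrite !in_itv/= addr0 mulrC.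
  move=> [[/andP[x0 xu] Cx] _]; split => //.
  by rewrite divr_gt0//= ltr_pdivrMr// mul1r.
move=> [Cx]; rewrite ltr_pdivlMr// ltr_pdivrMr// mul1r mul0r => /andP[-> xu].
by rewrite xu (lt_trans xu u1).
Qed.

(** * The uniform law on the cube *)

Definition box (R : realType) m (B : 'I_m -> set R) : set (m.-tuple R) :=
  [set t | forall i, B i (tnth t i)].

(** This says that the coordinates are independent and uniform on [[0, 1]]. It is
    a predicate on measures, so that no product measure on tuples has to be
    constructed. *)
Definition uniform_cube (R : realType) m (mu : set (m.-tuple R) -> \bar R) : Prop :=
  forall B : 'I_m -> set R, (forall i, measurable (B i)) ->
    mu (box B) = (\prod_i U01 R (B i))%E.

Lemma measurable_box (R : realType) m (B : 'I_m -> set R) :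
  (forall i, measurable (B i)) -> measurable (box B).
Proof.
move=> mB; rewrite (_ : box B = \bigcap_(i in [set: 'I_m])
    ((@tnth m R)^~ i @^-1` B i)).
  apply: fin_bigcap_measurable; first exact: finite_finset.
  by move=> i _; apply: measurable_preimageT => //; exact: measurable_tnth.
by apply/seteqP; split => t /=; [move=> tB i _; exact: tB|move=> tB i; exact: tB].
Qed.

(** Boxes are stable under intersection and generate the sigma-algebra of tuples. *)
Lemma box_measure_unique (R : realType) m
    (mu nu : {measure set (m.-tuple R) -> \bar R}) :
  (mu setT < +oo)%E ->
  (forall B : 'I_m -> set R, (forall i, measurable (B i)) ->
    mu (box B) = nu (box B)) ->
  forall E, measurable E -> mu E = nu E.
Proof.
move=> mu_fin munu.
pose G := [set E | exists2 B : 'I_m -> set R, (forall i, measurable (B i)) &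
  E = box B].
have GT : G setT.
  by exists (fun=> setT) => //; apply/seteqP; split.
apply: (measure_unique G (fun=> setT)) => //.
- apply/seteqP; split.
  + apply: smallest_sub; first exact: smallest_sigma_algebra.
    move=> E; rewrite -bigcup_seq => -[i _ [A mA <-]].
    apply: sub_sigma_algebra; exists (fun j => if j == i then A else setT).
      by move=> j; case: ifP.
    rewrite setTI; apply/seteqP; split => t /= tA.
      by move=> j; case: eqP => // ->.
    by have := tA i; rewrite eqxx.
  + apply: smallest_sub; first exact: sigma_algebra_measurable.
    by move=> _ [B mB ->]; exact: measurable_box.
- move=> _ _ [B mB ->] [C mC ->]; exists (fun i => B i `&` C i).
    by move=> i; exact: measurableI.
  apply/seteqP; split => t /=.
    by move=> [tB tC] i; split; [exact: tB|exact: tC].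
  by move=> H; split => i; have [] := H i.
- by rewrite bigcup_const //; exists 0%N.
- by move=> _ [B mB ->]; exact: munu.
Qed.

Lemma uniform_cube_unique (R : realType) m
    (mu nu : {measure set (m.-tuple R) -> \bar R}) :
  uniform_cube mu -> uniform_cube nu ->
  forall E, measurable E -> mu E = nu E.
Proof.
move=> cmu cnu; apply: box_measure_unique; last by move=> B mB; rewrite cmu ?cnu.
rewrite (_ : setT = box (fun=> setT)); last by apply/seteqP; split.
by rewrite cmu// big1 ?ltry// => i _; rewrite probability_setT.
Qed.

Lemma uniform_cube_map (R : realType) m (mu : {measure set (m.-tuple R) -> \bar R})
    (f : R -> R) (E : set (m.-tuple R)) :
  uniform_cube mu -> preserves_U01 f -> measurable E ->
  mu [set t | E (map_tuple f t)] = mu E.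
Proof.
move=> cmu [mf fU] mE.
have mg : measurable_fun [set: m.-tuple R] (map_tuple f).
  apply/measurable_fun_tnthP => i.
  rewrite (_ : _ \o _ = f \o (@tnth m R)^~ i).
    by apply: measurableT_comp => //; exact: measurable_tnth.
  by apply/funext => t /=; rewrite tnth_map.
have [nu nuE] := pushforward_measureP mu mg.
rewrite -[LHS]nuE; apply: uniform_cube_unique => // B mB.
rewrite nuE (_ : _ @^-1` _ = box (fun i => f @^-1` B i)).
  rewrite cmu; last by move=> i; exact: measurable_preimageT.
  by apply: eq_bigr => i _; exact: fU.
by apply/seteqP; split => t tB i; have := tB i; rewrite /= tnth_map.
Qed.

Lemma uniform_cube_perm (R : realType) m (mu : {measure set (m.-tuple R) -> \bar R})
    (s : {perm 'I_m}) (E : set (m.-tuple R)) :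
  uniform_cube mu -> measurable E ->
  mu [set t | E [tuple tnth t (s i) | i < m]] = mu E.
Proof.
move=> cmu mE.
have mg : measurable_fun setT (fun t : m.-tuple R => [tuple tnth t (s i) | i < m]).
  apply/measurable_fun_tnthP => i.
  rewrite (_ : _ \o _ = (@tnth m R)^~ (s i)); first exact: measurable_tnth.
  by apply/funext => t /=; rewrite tnth_mktuple.
have [nu nuE] := pushforward_measureP mu mg.
rewrite -[LHS]nuE; apply: uniform_cube_unique => // B mB.
rewrite nuE (_ : _ @^-1` _ = box (fun i => B (s^-1%g i))).
  by rewrite cmu// (reindex_perm s)/=; apply: eq_bigr => i _; rewrite permK.
apply/seteqP; split => t tB i; have := tB (s i); have := tB (s^-1%g i);
  by rewrite /= !tnth_mktuple ?permKV ?permK.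
Qed.

(** The witness is the law of the last [m] coordinates: every dimension met in the
    induction gets its uniform law in this way. *)
Lemma uniform_cube_tail (R : realType) m (mu : probability (m.+1.-tuple R) R) :
  uniform_cube mu -> exists nu : probability (m.-tuple R) R, uniform_cube nu.
Proof.
move=> cmu; have [nu nuE] := pushforward_probabilityP mu (@measurable_behead _ R m).
exists nu => B mB; rewrite nuE.
pose C i := if unlift ord0 i is Some j then B j else setT.
rewrite (_ : _ @^-1` _ = box C).
  rewrite cmu; last by move=> i; rewrite /C; case: unlift.
  rewrite big_ord_recl {1}/C unlift_none probability_setT mul1e.
  by apply: eq_bigr => i _; rewrite /C liftK.
have behead_tnth (t : m.+1.-tuple R) i :
    tnth [tuple of behead t] i = tnth t (lift ord0 i).
  by rewrite [in RHS](tuple_eta t) tnthS.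
apply/seteqP; split => t tB i; last first.
  by have := tB (lift ord0 i); rewrite /C liftK -behead_tnth.
by rewrite /C; case: unliftP => // j ->; rewrite -behead_tnth; exact: tB.
Qed.

(** Fubini: the first coordinate is drawn, then the others. Any map preserving
    the uniform law may be applied to the first coordinate: the rotation argument
    compares the expressions obtained with the identity and with [u |-> 1 - u]. *)
Lemma uniform_cube_disintegrate (R : realType) m
    (mu : {measure set (m.+1.-tuple R) -> \bar R})
    (nu : probability (m.-tuple R) R) (f : R -> R) (E : set (m.+1.-tuple R)) :
  uniform_cube mu -> uniform_cube nu -> preserves_U01 f -> measurable E ->
  mu E = (\int[U01 R]_u nu [set t | E (cons_tuple (f u) t)])%E.
Proof.
move=> cmu cnu [mf fU] mE.
pose g (p : measurableTypeR R * m.-tuple R) : m.+1.-tuple R := cons_tuple (f p.1) p.2.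
have mg : measurable_fun setT g.
  apply: (@measurable_cons _ _ _ _ (fun p => f p.1) m snd) => //.
  exact: (measurableT_comp mf).
have [rho rhoE] := pushforward_measureP (U01 R \x nu)%E mg.
transitivity (rho E).
  apply: uniform_cube_unique => // B mB; rewrite rhoE.
  rewrite (_ : _ @^-1` _ = (f @^-1` B ord0) `*` box (fun i => B (lift ord0 i))).
    rewrite [LHS]product_measure1E; first last.
    - exact: measurable_box.
    - exact: (measurable_preimageT mf).
    rewrite big_ord_recl; congr (_ * _)%E; first exact: fU.
    exact: (cnu (fun i => B (lift ord0 i))).
  apply/seteqP; split => [[u t] tB|[u t] [uB tB] i].
    split => [|i]/=; first exact: (tB ord0).
    by have := tB (lift ord0 i); rewrite tnthS.
  case: (unliftP ord0 i) => [j ->|->]; last exact: uB.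
  by rewrite tnthS; exact: tB.
rewrite rhoE; apply: eq_integral => u _ /=.
by congr (nu _); apply/seteqP; split => t /=; rewrite xsectionP.
Qed.

(** Conditionally on all coordinates being below [u], their quotients by [u] again
    follow the uniform law of the cube. *)
Lemma uniform_cube_dilate (R : realType) m (mu : probability (m.-tuple R) R)
    (u : R) (E : set (m.-tuple R)) :
  uniform_cube mu -> 0 < u < 1 -> measurable E ->
  mu (box (fun=> [set x | 0 < x < u]) `&` [set t | E (map_tuple ( *%R^~ u^-1) t)]) =
  (mu (box (fun=> [set x | 0 < x < u]%R)) * mu E)%E.
Proof.
move=> cmu u01 mE.
pose D : set (m.-tuple R) := box (fun=> [set x | 0 < x < u]).
have mI := measurable_interval 0 u.
have mD : measurable D by exact: measurable_box.
have mg : measurable_fun [set: m.-tuple R] (map_tuple ( *%R^~ u^-1)).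
  apply/measurable_fun_tnthP => i.
  rewrite (_ : _ \o _ = (fun x => x * u^-1) \o (@tnth m R)^~ i).
    by apply: measurableT_comp; [exact: mulrr_measurable|exact: measurable_tnth].
  by apply/funext => t /=; rewrite tnth_map.
have [nu nuE] := pushforward_measureP (mrestr mu mD) mg.
have r0 : 0 <= fine (mu D) by rewrite fine_ge0// measure_ge0.
have rE : (fine (mu D))%:E = mu D by rewrite fineK// fin_num_measure.
transitivity (nu E); first by rewrite nuE /mrestr setIC.
transitivity (mscale (NngNum r0) mu E); last by rewrite /mscale/= rE.
apply: box_measure_unique => //.
  rewrite nuE -[X in (X < _)%E]/(mu ([set: m.-tuple R] `&` D)) setTI -rE.
  exact: ltry.
move=> B mB; rewrite nuE.
rewrite -[LHS]/(mu (map_tuple ( *%R^~ u^-1) @^-1` box B `&` D)).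
rewrite -[RHS]/((fine (mu D))%:E * mu (box B))%E rE.
have -> : map_tuple ( *%R^~ u^-1) @^-1` box B `&` D =
    box (fun i => [set x | 0 < x < u /\ B i (x / u)]).
  apply/seteqP; split => t /=.
    by move=> [tB tD] i; split; [exact: tD|have := tB i; rewrite tnth_map].
  by move=> tBD; split => i; have [] := tBD i => //; rewrite tnth_map.
rewrite !cmu//.
  rewrite -big_split/=; apply: eq_bigr => i _; exact: U01_dilate.
move=> i; rewrite (_ : mkset _ = [set x : R | 0 < x < u] `&` ( *%R^~ u^-1) @^-1` B i)//.
apply: measurableI => //; apply: measurable_preimageT => //.
exact: mulrr_measurable.
Qed.

(** * Breaking points and lengths of pieces *)

(** The consecutive lengths on a stick from [a] to [b] broken at the sorted points
    [s]; arbitrary endpoints are needed to cut a stick at one of its breaking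
    points. *)
Definition gaps (R : realType) (a : R) (s : seq R) (b : R) : seq R :=
  pairmap (fun x y => y - x) a (rcons s b).

Lemma size_gaps (R : realType) (a : R) s b : size (gaps a s b) = (size s).+1.
Proof. by rewrite /gaps size_pairmap size_rcons. Qed.

Lemma gaps_cat (R : realType) (a u b : R) s1 s2 :
  gaps a (s1 ++ u :: s2) b = gaps a s1 u ++ gaps u s2 b.
Proof.
by rewrite /gaps -cat_rcons rcons_cat pairmap_cat last_rcons.
Qed.

Lemma gaps_shift (R : realType) (c a b : R) s :
  gaps (a + c) [seq x + c | x <- s] (b + c) = gaps a s b.
Proof.
rewrite /gaps -map_rcons; elim: (rcons s b) a => //= x r IH a.
by rewrite IH; congr (_ :: _); ring.
Qed.

Lemma gaps_dilate (R : realType) (c a b : R) s :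
  gaps (a * c) [seq x * c | x <- s] (b * c) = [seq x * c | x <- gaps a s b].
Proof.
rewrite /gaps -map_rcons; elim: (rcons s b) a => //= x r IH a.
by rewrite IH; congr (_ :: _); ring.
Qed.

Lemma pieceE (R : realType) m (t : m.-tuple R) i :
  piece (tnth t) i = nth 0 (gaps 0 (sort <=%R t) 1) i.
Proof. by rewrite /piece /pieces /codom /image_mem map_tnth_enum. Qed.

Lemma sort_cons_split (R : realType) (u : R) (t s1 s2 : seq R) :
  sorted <=%R s1 -> sorted <=%R s2 -> perm_eq t (s1 ++ s2) ->
  {in s1, forall x, x <= u} -> {in s2, forall x, u <= x} ->
  sort <=%R (u :: t) = s1 ++ u :: s2.
Proof.
move=> ss1 ss2 ts le1 le2; apply: le_sorted_eq.
- exact: sort_le_sorted.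
- rewrite sorted_pairwise; last exact: le_trans.
  rewrite pairwise_cat /= -!sorted_pairwise ?ss1 ?ss2; try exact: le_trans.
  rewrite !andbT; apply/andP; split.
    apply/allrelP => x y xs1; rewrite inE => /orP[/eqP ->|ys2]; first exact: le1.
    exact: le_trans (le1 _ xs1) (le2 _ ys2).
  by apply/allP => y /le2.
- rewrite perm_sort perm_sym perm_catC /= perm_cons perm_sym (permPl ts).
  by rewrite perm_catC.
Qed.

Lemma sort_map_mono (R : realType) (f : R -> R) (s : seq R) :
  {mono f : x y / x <= y} ->
  sort <=%R [seq f x | x <- s] = [seq f x | x <- sort <=%R s].
Proof.
move=> fm; rewrite sort_map; congr (map _ (sort _ _)).
by apply/funext => x; apply/funext => y; exact: fm.
Qed.

(** The gaps of [u :: t] split at [u] into those of [[0, u]] and those of [[u, 1]].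
    Rotating by [u] exchanges the two blocks by translations: the old breaking
    point [u] becomes the two ends of the stick, and the old ends become the
    breaking point [1 - u]. *)
Lemma gaps_rotate (R : realType) (u : R) (t : seq R) :
  0 < u < 1 -> {in t, forall x, 0 < x < 1 /\ x != u} ->
  gaps 0 (sort <=%R (1 - u :: [seq rotate u x | x <- t])) 1 =
  rot (count (< u) t).+1 (gaps 0 (sort <=%R (u :: t)) 1).
Proof.
move=> u01 tP.
set lo := sort <=%R [seq x <- t | x < u].
set hi := sort <=%R [seq x <- t | u < x].
have loP x : x \in lo -> 0 < x < u.
  by rewrite mem_sort mem_filter => /andP[-> /tP[/andP[->]]].
have hiP x : x \in hi -> u < x < 1.
  by rewrite mem_sort mem_filter => /andP[-> /tP[/andP[_ ->]]].
have t_lohi : perm_eq t (lo ++ hi).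
  rewrite perm_sym -(permPr (permEl (perm_filterC (fun x => x < u) t))).
  apply: perm_cat; rewrite perm_sort//.
  suff -> : [seq x <- t | u < x] = [seq x <- t | predC (< u) x] by [].
  apply: eq_in_filter => x /tP[_ xu] /=.
  by rewrite -leNgt [in RHS]le_eqVlt eq_sym (negbTE xu).
have rot_lo : [seq rotate u x | x <- lo] = [seq x + (1 - u) | x <- lo].
  by apply/eq_in_map => x /loP xu; rewrite /rotate ifT//; ring.
have rot_hi : [seq rotate u x | x <- hi] = [seq x + - u | x <- hi].
  apply/eq_in_map => x /hiP xu; rewrite /rotate ifF; last by apply/negbTE; lra.
  by rewrite ifT.
have -> : sort <=%R (u :: t) = lo ++ u :: hi.
  apply: sort_cons_split => //; try exact: sort_le_sorted.
    by move=> x /loP/andP[_ /ltW].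
  by move=> x /hiP/andP[/ltW].
have -> : sort <=%R (1 - u :: [seq rotate u x | x <- t]) =
    [seq x + - u | x <- hi] ++ (1 - u) :: [seq x + (1 - u) | x <- lo].
  apply: sort_cons_split.
  - rewrite sorted_map; apply: (sub_sorted _ (sort_le_sorted _)) => x y /=.
    by rewrite lerD2r.
  - rewrite sorted_map; apply: (sub_sorted _ (sort_le_sorted _)) => x y /=.
    by rewrite lerD2r.
  - by rewrite -rot_lo -rot_hi perm_sym perm_catC -map_cat perm_sym perm_map.
  - by move=> _ /mapP[x /hiP xu ->]; lra.
  - by move=> _ /mapP[x /loP xu ->]; lra.
have g_hi : gaps 0 [seq x + - u | x <- hi] (1 - u) = gaps u hi 1.
  by rewrite -(gaps_shift (- u) u) subrr.
have g_lo : gaps (1 - u) [seq x + (1 - u) | x <- lo] 1 = gaps 0 lo u.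
  by rewrite -(gaps_shift (1 - u) 0) add0r (_ : u + (1 - u) = 1)//; ring.
have <- : size (gaps 0 lo u) = (count (< u) t).+1.
  by rewrite size_gaps size_sort size_filter.
by rewrite !gaps_cat g_hi g_lo rot_size_cat.
Qed.

Lemma count_rotate (R : realType) (u : R) (t : seq R) :
  0 < u < 1 -> {in t, forall x, 0 < x < 1 /\ x != u} ->
  count (< (1 - u)) [seq rotate u x | x <- t] = (size t - count (< u) t)%N.
Proof.
move=> u01 tP; rewrite -(count_predC (< u) t) addKn count_map.
apply: eq_in_count => x /tP[x01 xu] /=; rewrite -leNgt le_eqVlt eq_sym (negbTE xu)/=.
rewrite /rotate; have [ux|] := ltP u x.
  rewrite ifF; last by apply/negbTE; lra.
  by rewrite ifT; lra.
rewrite le_eqVlt (negbTE xu)/= => ux.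
by rewrite ifT; lra.
Qed.

Lemma rotate_arcs (R : realType) (u x : R) : 0 < u < 1 ->
  (0 < rotate u x < 1) && (rotate u x != 1 - u) = (0 < x < 1) && (x != u).
Proof.
move=> u01; rewrite /rotate; case: ifPn => [xu|xu].
  have -> : x != u by rewrite lt_eqF//; lra.
  have -> : x - u + 1 != 1 - u by rewrite gt_eqF//; lra.
  by rewrite !andbT; apply/idP/idP; lra.
case: ifPn => [ux|ux].
  have -> : x != u by rewrite gt_eqF//; lra.
  have -> : x - u != 1 - u by rewrite lt_eqF//; lra.
  by rewrite !andbT; apply/idP/idP; lra.
rewrite ltxx/=; apply/esym/negbTE/negP => /andP[x01].
by rewrite neq_lt => /orP[]; lra.
Qed.

Lemma gaps_last_max (R : realType) (u : R) (t : seq R) :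
  {in t, forall x, x <= u} ->
  gaps 0 (sort <=%R (u :: t)) 1 = rcons (gaps 0 (sort <=%R t) u) (1 - u).
Proof.
move=> tu; rewrite (@sort_cons_split _ _ _ (sort <=%R t) [::])//.
- by rewrite gaps_cat cats1.
- exact: sort_le_sorted.
- by rewrite cats0 perm_sym perm_sort.
- by move=> x; rewrite mem_sort; exact: tu.
Qed.

(** The polygon inequality depends neither on the order of the pieces nor on the
    unit of length. *)
Lemma forms_polygon_reindex (R : realType) a b (f : 'I_a -> 'I_b) (c : R)
    (l : 'I_b -> R) (l' : 'I_a -> R) (A : {set 'I_b}) :
  0 < c -> injective f -> (forall i, l' i = l (f i) * c) ->
  A \subset codom f ->
  forms_polygon l' (f @^-1: A) = forms_polygon l A.
Proof.
move=> c0 finj l'E Af.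
have lift i : i \in A -> exists2 i', i' \in f @^-1: A & i = f i'.
  move=> iA; have /codomP[i' ie] := fintype.subsetP Af i iA.
  by exists i'; rewrite ?inE -?ie.
have sumE j : \sum_(i in f @^-1: A :\ j) l' i = (\sum_(i in A :\ f j) l i) * c.
  rewrite mulr_suml.
  have -> : A :\ f j = f @: (f @^-1: A :\ j).
    apply/setP => i; apply/idP/imsetP.
      rewrite !inE => /andP[ij /lift[i' i'A ie]]; exists i' => //.
      by rewrite in_setD1 i'A andbT; apply: contraNneq ij => <-; rewrite ie.
    by move=> [i']; rewrite !inE => /andP[i'j fA] ->; rewrite (inj_eq finj) i'j.
  rewrite big_imset/=; last by move=> x y _ _; exact: finj.
  by apply: eq_bigr => i _; rewrite l'E.
apply/existsP/existsP => -[j /and3P[jA /forallP jmax jlt]].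
- exists (f j); apply/and3P; split; first by rewrite inE in jA.
    apply/forallP => i; apply/implyP => /lift[i' i'A ->].
    by have := jmax i'; rewrite i'A/= !l'E ler_pM2r.
  by rewrite -(ltr_pM2r c0) -sumE -l'E.
- have [j' j'A je] := lift j jA; exists j'; apply/and3P; split => //.
    apply/forallP => i; apply/implyP => iA.
    by rewrite !l'E ler_pM2r// -je; apply: (implyP (jmax (f i))); rewrite inE in iA.
  by rewrite sumE l'E ltr_pM2r// -je.
Qed.

(** * Measurability of the events *)

Lemma measurable_set_bool d (T : measurableType d) (b : T -> bool) :
  measurable_fun setT b -> measurable [set w | b w].
Proof.
move=> mb; rewrite (_ : mkset _ = b @^-1` [set true]); first exact: measurable_preimageT.
by apply/seteqP; split.
Qed.

Lemma measurable_set_forall d (T : measurableType d) (I : finType)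
    (b : I -> T -> bool) :
  (forall i, measurable_fun setT (b i)) -> measurable [set w | forall i, b i w].
Proof.
move=> mb; rewrite (_ : mkset _ = \bigcap_(i in [set: I]) [set w | b i w]).
  apply: fin_bigcap_measurable; first exact: finite_finset.
  by move=> i _; exact: measurable_set_bool.
by apply/seteqP; split => w /=; [move=> bw i _|move=> bw i]; exact: bw.
Qed.

Lemma measurable_count d (T : measurableType d) n (b : 'I_n -> T -> bool) :
  (forall i, measurable_fun setT (b i)) ->
  measurable_fun setT (fun w => \sum_(i < n | b i w) 1)%N.
Proof.
move=> mb; under eq_fun do rewrite big_mkcond/=.
elim: (index_enum _) => [|i r IH].
  by under eq_fun do rewrite big_nil; exact: measurable_cst.
under eq_fun do rewrite big_cons.
apply: measurable_fun_addn => //.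
by apply: measurable_fun_ifT => //; exact: mb.
Qed.

Lemma count_tuple T n (t : n.-tuple T) (p : pred T) :
  count p t = (\sum_(i < n | p (tnth t i)) 1)%N.
Proof. by rewrite -sum1_count big_tuple. Qed.

(** The [i]-th smallest coordinate exceeds [a] if and only if at most [i]
    coordinates are at most [a]. *)
Lemma measurable_order_statistic (R : realType) m i : (i < m)%N ->
  measurable_fun setT (fun t : m.-tuple R => nth 0 (sort <=%R t) i).
Proof.
move=> im _; apply: (measurability _ (RGenOInfty.measurableE R)) => //.
move=> _ [_ [a ->] <-]; rewrite setTI.
rewrite (_ : _ @^-1` _ = [set t : m.-tuple R |
    (\sum_(j < m | (tnth t j <= a)%R) 1 <= i)%N]).
  apply: measurable_set_bool; apply: measurable_fun_leq => //.
  apply: measurable_count => j; apply: measurable_fun_ler => //.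
  exact: measurable_tnth.
apply/seteqP; split => t /=; rewrite in_itv/= andbT -(count_tuple t (<= a)).
  move=> at_; rewrite leqNgt; apply: contraTN at_ => ia.
  rewrite -leNgt; apply: nth_count_le; first exact: sort_le_sorted.
  by rewrite (seq.permP (permEl (perm_sort _ _))).
move=> ia; apply: nth_count_gt; first exact: sort_le_sorted.
by rewrite (seq.permP (permEl (perm_sort _ _))) ia size_sort size_tuple.
Qed.

Lemma measurable_piece (R : realType) m i : (i <= m)%N ->
  measurable_fun setT (fun t : m.-tuple R => piece (tnth t) i).
Proof.
move=> im; under eq_fun do
  rewrite pieceE (nth_pairmap 0) ?size_rcons ?size_sort ?size_tuple ?ltnS//.
have mr k : measurable_fun setT
    (fun t : m.-tuple R => nth 0 (rcons (sort <=%R t) 1) k).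
  under eq_fun do rewrite nth_rcons size_sort size_tuple.
  have [km|km] := ltnP k m; last exact: measurable_cst.
  exact: measurable_order_statistic.
apply: measurable_funB; first exact: mr.
by case: i im => [|i] im; [exact: measurable_cst|exact: mr].
Qed.

Lemma measurable_non_polygon d (T : measurableType d) (R : realType) n
    (L : 'I_n -> T -> R) (A : {set 'I_n}) :
  (forall i, measurable_fun setT (L i)) ->
  measurable [set w | ~~ forms_polygon (L^~ w) A].
Proof.
move=> mL.
(* The bound by l j is expressed by counting its violations. *)
have -> : [set w | ~~ forms_polygon (L^~ w) A] = [set w | forall j,
    ~~ ((j \in A) &&
        ((\sum_(i < n | (i \in A) && ~~ (L i w <= L j w)%R) 1 <= 0)%N &&
         (L j w < \sum_(i in A :\ j) L i w)))].
  apply/seteqP; split => w /=; rewrite /forms_polygon.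
    rewrite negb_exists => /forallP H j; have := H j; apply: contra.
    move=> /and3P[-> s0 ->]; rewrite andbT/=; apply/forallP => i; apply/implyP => iA.
    move: s0; rewrite leqn0 sum_nat_eq0 => /forallP/(_ i); rewrite iA/=.
    by case: (_ <= _).
  move=> H; rewrite negb_exists; apply/forallP => j; have := H j; apply: contra.
  move=> /and3P[-> /forallP le_j ->]; rewrite andbT/= leqn0 sum_nat_eq0.
  by apply/forallP => i; apply/implyP => /andP[iA]; have := le_j i; rewrite iA/= => ->.
apply: measurable_set_forall => j; apply: measurable_neg.
apply: measurable_and; first exact: measurable_cst.
apply: measurable_and.
  apply: measurable_fun_leq => //; apply: measurable_count => i.
  apply: measurable_and; first exact: measurable_cst.
  by apply: measurable_neg; exact: measurable_fun_ler.
apply: measurable_fun_ltr => //.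
under eq_fun do rewrite big_mkcond/=.
apply: measurable_sum => i.
by apply: measurable_fun_ifT => //; exact: measurable_cst.
Qed.

Definition non_polygon (R : realType) m (A : {set 'I_m.+1}) : set (m.-tuple R) :=
  [set t | ~~ forms_polygon (fun i : 'I_m.+1 => piece (tnth t) i) A].

Lemma measurable_non_polygon_tuple (R : realType) m (A : {set 'I_m.+1}) :
  measurable (@non_polygon R m A).
Proof.
apply: (@measurable_non_polygon _ _ R _ (fun i t => piece (tnth t) i)) => i.
by apply: measurable_piece; rewrite -ltnS.
Qed.

(** Up to a null set this is the whole cube. The condition concerns only the ties
    with the coordinate [i], because it must be read off, after drawing that
    coordinate, on each of the others separately. *)
Definition generic (R : realType) m (i : 'I_m) : set (m.-tuple R) :=
  [set t | forall l, (0 < tnth t l < 1) && ((l == i) || (tnth t l != tnth t i))].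

Definition generic_rank (R : realType) m (i : 'I_m) (j : nat) : set (m.-tuple R) :=
  generic i `&` [set t | count (< tnth t i) t = j].

Lemma measurable_generic (R : realType) m (i : 'I_m) : measurable (@generic R m i).
Proof.
have mt k := @measurable_tnth _ R m k.
apply: measurable_set_forall => l; apply: measurable_and.
  by apply: measurable_and; apply: measurable_fun_ltr => //; exact: mt.
apply: measurable_or; first exact: measurable_cst.
by apply: measurable_neg; apply: measurable_fun_eqr; exact: mt.
Qed.

Lemma measurable_generic_rank (R : realType) m (i : 'I_m) j :
  measurable (@generic_rank R m i j).
Proof.
apply: measurableI; first exact: measurable_generic.
rewrite (_ : mkset _ =
    [set t : m.-tuple R | (\sum_(l < m | (tnth t l < tnth t i)%R) 1)%N == j]).
  apply: measurable_set_bool; apply: measurable_fun_eqn => //.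
  by apply: measurable_count => l; apply: measurable_fun_ltr; exact: measurable_tnth.
by apply/seteqP; split => t /=; rewrite (count_tuple t (< tnth t i)) => /eqP.
Qed.

(** * The rank of a coordinate *)

Lemma U01_interior (R : realType) : U01 R [set x | 0 < x < 1] = 1%E.
Proof.
rewrite (_ : mkset _ = `]0, 1[%classic)//.
by rewrite U01E// setIid lebesgue_measure_itv/= lte_fin ltr01 sube0.
Qed.

Lemma preserves_U01_id (R : realType) : preserves_U01 (@id R).
Proof. by split. Qed.

(** By exchangeability one of the two coordinates may be taken to be the first;
    given its value, the other one avoids it almost surely. *)
Lemma uniform_cube_tie0 (R : realType) m (mu : probability (m.+1.-tuple R) R)
    (i l : 'I_m.+1) :
  uniform_cube mu -> l != i -> mu [set t | tnth t l == tnth t i] = 0%E.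
Proof.
move=> cmu li.
have mtie k k' : measurable [set t : m.+1.-tuple R | tnth t k == tnth t k'].
  apply: measurable_set_bool; apply: measurable_fun_eqr; exact: measurable_tnth.
pose s := tperm ord0 i.
have [l' sl'] : exists l', s l = lift ord0 l'.
  case: (unliftP ord0 (s l)) => [l' ->|sl0]; first by exists l'.
  by case/negP: li; rewrite -(tpermL ord0 i) -/s -sl0 tpermK.
transitivity (mu [set t | tnth t (lift ord0 l') == tnth t ord0]).
  rewrite -(uniform_cube_perm s cmu (mtie _ _)); congr (mu _).
  by apply/seteqP; split => t /=; rewrite !tnth_mktuple sl' tpermR.
have [nu cnu] := uniform_cube_tail cmu.
rewrite (uniform_cube_disintegrate cmu cnu (preserves_U01_id R) (mtie _ _)).
apply: integral0_eq => u _.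
pose B k : set R := if k == l' then [set u] else setT.
rewrite (_ : mkset _ = box B).
  rewrite cnu; last by move=> k; rewrite /B; case: ifP.
  rewrite (bigD1 l')//= {1}/B eqxx U01E// (_ : lebesgue_measure _ = 0%E) ?mul0e//.
  apply: countable_lebesgue_measure0; apply: (@sub_countable _ _ _ [set u]) => //.
  exact: subset_card_le.
apply/seteqP; split => t /=; rewrite tnthS.
  by move=> /eqP tl k; rewrite /B; case: eqP => // ->.
by move=> /(_ l'); rewrite /B eqxx => ->.
Qed.

Lemma generic_ae (R : realType) m (mu : probability (m.+1.-tuple R) R)
    (i : 'I_m.+1) : uniform_cube mu -> mu.-negligible (~` generic i).
Proof.
move=> cmu.
suff : {ae mu, forall t, generic i t} by [].
apply: filter_forall => l.
have box_ae : {ae mu, forall t : m.+1.-tuple R, 0 < tnth t l < 1}.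
  apply: (@negligibleS _ _ _ mu (~` box (fun=> [set x : R | 0 < x < 1]))).
    by move=> t /= tl H; apply: tl; exact: H.
  have mI := measurable_interval (0 : R) 1.
  apply/negligibleP; first by apply: measurableC; exact: measurable_box.
  transitivity (1 - mu (box (fun=> [set x : R | (0 < x < 1)%R])))%E.
    by apply: probability_setC; exact: measurable_box.
  by rewrite cmu// big1 ?subee// => k _; exact: U01_interior.
have tie_ae : {ae mu, forall t : m.+1.-tuple R, (l == i) || (tnth t l != tnth t i)}.
  have [->|li] := eqVneq l i; first exact: aeW.
  apply: (@negligibleS _ _ _ mu [set t | tnth t l == tnth t i]).
    by move=> t /= /negP; rewrite negbK.
  apply/negligibleP; last exact: uniform_cube_tie0.
  apply: measurable_set_bool; apply: measurable_fun_eqr; exact: measurable_tnth.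
by apply: filterS2 box_ae tie_ae => t -> ->.
Qed.

Lemma measure_bigcup_finType d (T : measurableType d) (R : realType)
    (mu : {measure set T -> \bar R}) (I : finType) (F : I -> set T) :
  (forall i, measurable (F i)) -> trivIset setT F ->
  mu (\bigcup_(i in [set: I]) F i) = (\sum_(i : I) mu (F i))%E.
Proof.
move=> mF tF; rewrite measure_fin_bigcup//; last exact: finite_finset.
rewrite [RHS]fsbig_seq; last exact: index_enum_uniq.
by apply: eq_fsbigl; apply/seteqP; split => i //= _; rewrite mem_index_enum.
Qed.

Lemma rank_strict (R : realType) m (t : m.-tuple R) (i l : 'I_m) :
  tnth t i < tnth t l -> (count (< tnth t i) t < count (< tnth t l) t)%N.
Proof.
move=> il; rewrite !count_tuple !sum1dep_card; apply: proper_card.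
apply/fintype.properP; split; last by exists i; rewrite !inE ?ltxx.
by apply/fintype.subsetP => k; rewrite !inE => /lt_trans; apply.
Qed.

(** Almost surely exactly one of the [m.+1] coordinates has rank [j], and by
    exchangeability each is equally likely to be that one, whatever the symmetric
    event [E]. Hence one may assume that it is the first coordinate, the one that
    [uniform_cube_disintegrate] singles out. *)
Lemma uniform_cube_rank (R : realType) m (mu : probability (m.+1.-tuple R) R)
    (E : set (m.+1.-tuple R)) j :
  uniform_cube mu -> measurable E ->
  (forall t t' : m.+1.-tuple R, perm_eq t t' -> E t -> E t') -> (j <= m)%N ->
  mu E = (m.+1%:R%:E * mu (E `&` generic_rank ord0 j))%E.
Proof.
move=> cmu mE Eperm jm.
have mEr i : measurable (E `&` @generic_rank R m.+1 i j).
  by apply: measurableI => //; exact: measurable_generic_rank.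
have Er_sym i : mu (E `&` generic_rank i j) = mu (E `&` generic_rank ord0 j).
  pose s := tperm ord0 i.
  rewrite -(uniform_cube_perm s cmu (mEr ord0)); congr (mu _).
  have ptt (t : m.+1.-tuple R) : perm_eq [tuple tnth t (s k) | k < m.+1] t.
    by apply/tuple_permP; exists s.
  have s_eq k : (s k == i) = (k == ord0).
    by rewrite -(inj_eq (@perm_inj _ s)) tpermK tpermR.
  have gen_s (t : m.+1.-tuple R) :
      generic ord0 [tuple tnth t (s k) | k < m.+1] <-> generic i t.
    split => tgen l.
      by have := tgen (s l); rewrite !tnth_mktuple tpermK tpermL -s_eq tpermK.
    by have := tgen (s l); rewrite !tnth_mktuple tpermL s_eq.
  apply/seteqP; split => t [Et [/gen_s tgen trank]]; split.
  - by apply: Eperm Et; rewrite perm_sym.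
  - by split => //=; rewrite tnth_mktuple tpermL (seq.permP (ptt t)).
  - by apply: Eperm Et.
  - by split => //; move: trank; rewrite /= tnth_mktuple tpermL (seq.permP (ptt t)).
transitivity (mu (\bigcup_(i in [set: 'I_m.+1]) (E `&` generic_rank i j))).
  have mU : measurable (\bigcup_(i in [set: 'I_m.+1]) (E `&` @generic_rank R m.+1 i j)).
    by apply: fin_bigcup_measurable; first exact: finite_finset.
  have mG : measurable (\bigcup_(i in [set: 'I_m.+1]) @generic_rank R m.+1 i j).
    apply: fin_bigcup_measurable; first exact: finite_finset.
    by move=> i _; exact: measurable_generic_rank.
  rewrite -[in LHS](setIT E) -(setUv (\bigcup_(i in [set: 'I_m.+1]) generic_rank i j)).
  rewrite setIUr measureU0 ?setI_bigcupr//.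
    by apply: measurableI => //; exact: measurableC.
  apply/negligibleP; first by apply: measurableI => //; exact: measurableC.
  have all_gen : {ae mu, forall t, forall i, generic i t}.
    by apply: filter_forall => i; exact: generic_ae.
  apply: negligibleS all_gen => t [_ tNr] tgen; apply: tNr.
  have rank_lt i : (count (< tnth t i) t < m.+1)%N.
    rewrite -[X in (_ < X)%N](size_tuple t) -(count_predC (< tnth t i) t).
    rewrite -[ltnLHS]addn0 ltn_add2l -has_count; apply/hasP.
    by exists (tnth t i); rewrite ?mem_tnth//= ltxx.
  have rank_inj : injective (fun i => Ordinal (rank_lt i)).
    move=> i l [il]; apply/eqP; apply: contraT => neq_il.
    have /andP[_] := tgen l i; rewrite (negbTE neq_il)/= neq_lt.
    by move=> /orP[] /rank_strict; rewrite il ltnn.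
  (* The ranks of distinct coordinates are distinct, so every rank is attained. *)
  have [g _ gK] := injF_bij rank_inj.
  exists (g (inord j)) => //; split; first exact: tgen.
  by have := congr1 val (gK (inord j)); rewrite /= inordK.
rewrite measure_bigcup_finType//.
- by rewrite (eq_bigr _ (fun i _ => Er_sym i)) sumr_const card_ord mule_natl.
- apply: trivIset_setIl => i l _ _ [t [[igen irank] [lgen lrank]]].
  apply/eqP; apply: contraT => neq_il.
  have /andP[_] := lgen i; rewrite (negbTE neq_il)/= neq_lt.
  by move=> /orP[] /rank_strict; rewrite irank lrank ltnn.
Qed.

(** * Discarding the last piece *)

Lemma non_polygon_perm (R : realType) m (A : {set 'I_m.+1}) (t t' : m.-tuple R) :
  perm_eq t t' -> non_polygon A t -> non_polygon A t'.
Proof.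
move=> tt'; rewrite /non_polygon/=.
suff -> : (fun i : 'I_m.+1 => piece (tnth t) i) =
    (fun i : 'I_m.+1 => piece (tnth t') i) by [].
apply/funext => i; rewrite !pieceE; congr (nth _ (gaps _ _ _) _).
by apply/perm_sortP => //; [exact: le_total|exact: le_trans|exact: le_anti].
Qed.

Lemma generic_rank_cons (R : realType) m (u : R) (t : m.-tuple R) j :
  generic_rank ord0 j (cons_tuple u t) <->
  [/\ 0 < u < 1, {in t, forall x, 0 < x < 1 /\ x != u} & count (< u) t = j].
Proof.
have rankE : count (< u) (u :: t) = count (< u) t by rewrite /= ltxx.
split=> [[tgen trank]|[u01 tP trank]].
  split; first by have /andP[] := tgen ord0.
    move=> _ /tnthP[i ->]; have := tgen (lift ord0 i).
    by rewrite tnthS tnth0 => /andP[].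
  by rewrite -rankE.
split; last by rewrite /= tnth0 ltxx.
move=> l; case: (unliftP ord0 l) => [i ->|->]; last by rewrite tnth0 u01 eqxx.
by rewrite tnthS tnth0; have [-> ->] := tP _ (mem_tnth i t); rewrite orbT.
Qed.

Lemma generic_rank_max (R : realType) m (u : R) (t : m.-tuple R) : 0 < u < 1 ->
  generic_rank ord0 m (cons_tuple u t) <-> box (fun=> [set x | 0 < x < u]) t.
Proof.
move=> u01; split=> [/generic_rank_cons[_ tP trank] i /=|tB].
  have [/andP[-> _] _] := tP _ (mem_tnth i t).
  suff /allP/(_ _ (mem_tnth i t)) : all (< u) t by [].
  by rewrite all_count trank size_tuple.
apply/generic_rank_cons; split => //.
  by move=> _ /tnthP[i ->]; have := tB i => /= ti; rewrite lt_eqF//; lra.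
rewrite -[X in _ = X](size_tuple t); apply/eqP; rewrite -all_count.
by apply/allP => _ /tnthP[i ->]; have /andP[] := tB i.
Qed.

(** If [u] is the last breaking point, the pieces other than the last one are the
    pieces of the stick [[0, u]], that is, up to the factor [u], those of the unit
    stick broken at the points of [t] divided by [u]. *)
Lemma cons_max_drop (R : realType) m (A : {set 'I_m.+2}) (u : R) (t : m.-tuple R) :
  ord_max \notin A -> 0 < u < 1 ->
  (non_polygon A `&` generic_rank ord0 m) (cons_tuple u t) <->
  (box (fun=> [set x | 0 < x < u]) `&`
   [set t | non_polygon (lift ord_max @^-1: A) (map_tuple ( *%R^~ u^-1) t)]) t.
Proof.
move=> maxA u01; have u0 : 0 < u by lra.
have cP := generic_rank_max t u01.
suff npE : box (fun=> [set x | 0 < x < u]) t ->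
    non_polygon A (cons_tuple u t) =
    non_polygon (lift ord_max @^-1: A) (map_tuple ( *%R^~ u^-1) t).
  split=> [[tA /cP tB]|[tB tA]]; split => //.
  - by rewrite /= -(npE tB).
  - by rewrite (npE tB).
  - exact/cP.
move=> tB; rewrite /non_polygon/=; congr (is_true (~~ _)); apply/esym.
apply: (@forms_polygon_reindex _ _ _ _ u^-1).
- by rewrite invr_gt0.
- exact: lift_inj.
- move=> i; rewrite !pieceE gaps_last_max; last first.
    by move=> _ /tnthP[k ->]; have := tB k => /= tk; lra.
  rewrite nth_rcons size_gaps size_sort size_tuple lift_max ltn_ord.
  rewrite sort_map_mono; last by move=> x y; rewrite /= ler_pM2r ?invr_gt0.
  have := gaps_dilate u^-1 0 u (sort <=%R t); rewrite mul0r divff ?gt_eqF// => ->.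
  rewrite (nth_map 0)//.
  by rewrite size_gaps size_sort size_tuple.
- apply/fintype.subsetP => i iA; case: (unliftP ord_max i) => [k ->|ie].
    exact: codom_f.
  by rewrite ie (negbTE maxA) in iA.
Qed.

Lemma measurable_fun_section (R : realType) m (nu : probability (m.-tuple R) R)
    (E : set (m.+1.-tuple R)) : measurable E ->
  measurable_fun setT
    ((fun u => nu [set t | E (cons_tuple u t)]) : measurableTypeR R -> \bar R).
Proof.
move=> mE.
pose g (p : measurableTypeR R * m.-tuple R) : m.+1.-tuple R := cons_tuple p.1 p.2.
have mg : measurable_fun setT g by exact: (@measurable_cons _ _ _ _ fst m snd).
rewrite (_ : (fun _ => _) = nu \o xsection (g @^-1` E)).
  apply: measurable_fun_xsection; exact: measurable_preimageT.
apply/funext => u /=; congr (nu _); apply/seteqP; split => t /=; rewrite xsectionP//.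
Qed.

(** Condition on the first coordinate being the largest. The rescaled remaining
    points are then uniform and independent of this condition
    ([uniform_cube_dilate]), so the probability is a product; multiplying by
    [m.+1] removes the condition on both sides ([uniform_cube_rank]), which
    spares the evaluation of the integral of [u ^+ m]. *)
Lemma non_polygon_drop_last (R : realType) m (mu : probability (m.+1.-tuple R) R)
    (nu : probability (m.-tuple R) R) (A : {set 'I_m.+2}) :
  uniform_cube mu -> uniform_cube nu -> ord_max \notin A ->
  mu (non_polygon A) = nu (non_polygon (lift ord_max @^-1: A)).
Proof.
move=> cmu cnu maxA.
have mgr := @measurable_generic_rank R m.+1 ord0 m.
have mnp (B : {set 'I_m.+2}) := @measurable_non_polygon_tuple R _ B.
set p := nu _.
pose h u := nu [set t | generic_rank ord0 m (cons_tuple u t)].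
have mu_np : mu (non_polygon A `&` generic_rank ord0 m) =
    (mu (generic_rank ord0 m) * p)%E.
  rewrite (uniform_cube_disintegrate cmu cnu (preserves_U01_id R) mgr).
  rewrite -[in RHS]ge0_integralZr//.
  - rewrite (uniform_cube_disintegrate cmu cnu (preserves_U01_id R)).
    + apply: eq_integral => u _.
      rewrite /= -/(h u) /h; have [u01|u01] := boolP (0 < u < 1).
        rewrite [LHS](_ : _ = nu (box (fun=> [set x | 0 < x < u]) `&`
            [set t | non_polygon (lift ord_max @^-1: A)
                       (map_tuple ( *%R^~ u^-1) t)])).
          rewrite (uniform_cube_dilate cnu u01); last first.
            exact: measurable_non_polygon_tuple.
          apply: (congr1 (fun X => nu X * p)%E).
          by apply/seteqP; split => t /(generic_rank_max t u01).
        by congr (nu _); apply/seteqP; split => t /= /(cons_max_drop _ maxA u01).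
      have gr0 : [set t : m.-tuple R | generic_rank ord0 m (cons_tuple u t)] = set0.
        by apply/seteqP; split => t //= /generic_rank_cons[]; rewrite (negbTE u01).
      rewrite (congr1 (fun X => nu X * p)%E gr0) measure0 mul0e.
      apply: etrans (measure0 nu); congr (nu _).
      by apply/seteqP; split => t //= [_]; have := congr1 (@^~ t) gr0 => /= ->.
    + exact: measurableI.
  - exact: measurable_fun_section.
  - exact: measure_ge0.
apply: etrans (uniform_cube_rank cmu (mnp A) (@non_polygon_perm R _ A) (leqnn m)) _.
rewrite mu_np muleA -[RHS]mul1e; congr (_ * _)%E.
rewrite -[generic_rank _ _]setTI -(probability_setT mu).
by apply/esym/(uniform_cube_rank cmu).
Qed.

(** * Rotating the pieces, and the theorem *)

Lemma nth_rot (T : Type) (x0 : T) (s : seq T) k i :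
  (k <= size s)%N -> (i < size s)%N ->
  nth x0 (rot k s) i = nth x0 s (if i + k < size s then i + k else i + k - size s)%N.
Proof.
move=> ks iks; rewrite /rot nth_cat size_drop nth_drop.
have -> : (i < size s - k)%N = (i + k < size s)%N by lia.
case: ifP => ik; first by rewrite addnC.
by rewrite nth_take; [congr nth; lia|lia].
Qed.

Definition shift_ord n (k : nat) (i : 'I_n.+1) : 'I_n.+1 :=
  inord (if i + k < n.+1 then i + k else i + k - n.+1)%N.

Lemma shift_ordE n k (i : 'I_n.+1) : (k <= n.+1)%N ->
  shift_ord k i = (if i + k < n.+1 then i + k else i + k - n.+1)%N :> nat.
Proof.
move=> kn; rewrite inordK//; have := ltn_ord i.
by case: ifP; lia.
Qed.

Lemma shift_ord_inj n k : (k <= n.+1)%N -> injective (@shift_ord n k).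
Proof.
move=> kn i l /(congr1 val); rewrite /= !shift_ordE// => il; apply/val_inj => /=.
by have := ltn_ord i; have := ltn_ord l; move: il; case: ifP; case: ifP; lia.
Qed.

(** When the first point [u] is the right end of the piece [j], rotating by [u]
    makes this piece the last one. *)
Lemma cons_rotate (R : realType) m (A : {set 'I_m.+2}) (u : R) (t : m.-tuple R) j :
  (j <= m)%N -> 0 < u < 1 ->
  (non_polygon (@shift_ord m.+1 j.+1 @^-1: A) `&` generic_rank ord0 (m - j))
     (cons_tuple (1 - u) (map_tuple (rotate u) t)) <->
  (non_polygon A `&` generic_rank ord0 j) (cons_tuple u t).
Proof.
move=> jm u01; have v01 : 0 < 1 - u < 1 by lra.
have grE : generic_rank ord0 (m - j) (cons_tuple (1 - u) (map_tuple (rotate u) t)) <->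
    generic_rank ord0 j (cons_tuple u t).
  have tE : {in t, forall x, 0 < x < 1 /\ x != u} <->
      {in map_tuple (rotate u) t, forall x, 0 < x < 1 /\ x != 1 - u}.
    split=> tP.
      by move=> _ /mapP[x /tP[x01 xu] ->]; apply/andP; rewrite rotate_arcs// x01.
    move=> x xt; apply/andP; rewrite -rotate_arcs//; apply/andP; apply: tP.
    exact: map_f.
  have := count_size (< u) t; rewrite size_tuple => cm.
  split=> /generic_rank_cons[_ tP trank]; apply/generic_rank_cons; split => //.
  - exact/tE.
  - by move: trank; rewrite count_rotate ?size_tuple//; [lia|exact/tE].
  - exact/tE.
  - by rewrite count_rotate// size_tuple trank.
suff npE : generic_rank ord0 j (cons_tuple u t) ->
    non_polygon (@shift_ord m.+1 j.+1 @^-1: A)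
      (cons_tuple (1 - u) (map_tuple (rotate u) t)) = non_polygon A (cons_tuple u t).
  split=> [[tA /grE tB]|[tA tB]]; split => //.
  - by rewrite -(npE tB).
  - by rewrite (npE tB).
  - exact/grE.
move=> /generic_rank_cons[_ tP trank].
rewrite /non_polygon/=; congr (is_true (~~ _)).
apply: (@forms_polygon_reindex _ _ _ _ 1) => //.
- by apply: shift_ord_inj; lia.
- move=> i; rewrite mulr1 !pieceE gaps_rotate// trank.
  rewrite nth_rot ?size_gaps ?size_sort ?size_tuple//; last lia.
  by rewrite shift_ordE; last lia.
- have sinj : injective (@shift_ord m.+1 j.+1) by apply: shift_ord_inj; lia.
  apply/fintype.subsetP => i _; have [g _ gK] := injF_bij sinj.
  by rewrite -(gK i) codom_f.
Qed.

(** Both probabilities are reduced to the case where the first coordinate has a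
    prescribed rank. Given its value [u], respectively [1 - u], the map [rotate u]
    on the other coordinates preserves their law and exchanges the two events. *)
Lemma non_polygon_rotate (R : realType) m (mu : probability (m.+1.-tuple R) R)
    (A : {set 'I_m.+2}) j :
  uniform_cube mu -> (j <= m)%N ->
  mu (non_polygon (@shift_ord m.+1 j.+1 @^-1: A)) = mu (non_polygon A).
Proof.
move=> cmu jm; have [nu cnu] := uniform_cube_tail cmu.
set A' := _ @^-1: A.
have mnp (B : {set 'I_m.+2}) := @measurable_non_polygon_tuple R _ B.
have mE (B : {set 'I_m.+2}) i : measurable (@non_polygon R _ B `&` generic_rank ord0 i).
  by apply: measurableI => //; exact: measurable_generic_rank.
apply: etrans
  (uniform_cube_rank cmu (mnp A') (@non_polygon_perm R _ A') (leq_subr j m)) _.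
apply: etrans _ (esym (uniform_cube_rank cmu (mnp A) (@non_polygon_perm R _ A) jm)).
congr (_ * _)%E.
rewrite (uniform_cube_disintegrate cmu cnu (U01_reflect R) (mE _ _)).
rewrite (uniform_cube_disintegrate cmu cnu (preserves_U01_id R) (mE _ _)).
apply: eq_integral => u _.
have [u01|u01] := boolP (0 < u < 1).
  have mS : measurable [set t : m.-tuple R |
      (non_polygon A' `&` generic_rank ord0 (m - j)) (cons_tuple (1 - u) t)].
    have mc : measurable_fun setT (fun t : m.-tuple R => cons_tuple (1 - u) t).
      by apply: (@measurable_cons _ _ _ _ (cst (1 - u)) m id).
    exact: (measurable_preimageT mc (mE _ _)).
  rewrite -(uniform_cube_map cnu (U01_rotate u01) mS).
  by congr (nu _); apply/seteqP; split => t /(cons_rotate A t jm u01).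
congr (nu _); apply/seteqP; split => t [_] /generic_rank_cons[].
  by move=> v01; case/negP: u01; lra.
by rewrite (negbTE u01).
Qed.

(** Induction on the number of points: as long as some piece is not in [A], it is
    rotated to the last place and discarded. *)
Lemma non_polygon_law (R : realType) m k (mu : probability (m.-tuple R) R)
    (nu : probability (k.-tuple R) R) (A : {set 'I_m.+1}) :
  uniform_cube mu -> uniform_cube nu -> #|A| = k.+1 ->
  mu (non_polygon A) = nu (non_polygon [set: 'I_k.+1]%SET).
Proof.
elim: m mu A => [|m IH] mu A cmu cnu cardA.
  have k0 : k = 0%N by have := max_card (mem A); rewrite cardA card_ord; lia.
  subst k; have -> : A = [set: 'I_1]%SET.
    by apply/eqP; rewrite eqEcard finset.subsetT cardsT card_ord cardA.
  by apply: uniform_cube_unique => //; exact: measurable_non_polygon_tuple.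
have [km|km] := eqVneq k m.+1.
  subst k; have -> : A = [set: 'I_m.+2]%SET.
    by apply/eqP; rewrite eqEcard finset.subsetT cardsT card_ord cardA leqnn.
  by apply: uniform_cube_unique => //; exact: measurable_non_polygon_tuple.
have [mu' cmu'] := uniform_cube_tail cmu.
have last_case (B : {set 'I_m.+2}) : ord_max \notin B -> #|B| = k.+1 ->
    mu (non_polygon B) = nu (non_polygon [set: 'I_k.+1]%SET).
  move=> maxB cardB; rewrite (non_polygon_drop_last cmu cmu' maxB); apply: IH => //.
  rewrite -cardB -(card_imset _ (@lift_inj _ ord_max)); apply: eq_card => i.
  apply/imsetP/idP => [[l]|iB]; first by rewrite inE => ? ->.
  case: (unliftP ord_max i) => [l ie|ie]; last by rewrite ie (negbTE maxB) in iB.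
  by exists l; rewrite // inE -ie.
have [j jA] : exists j, j \notin A.
  apply/existsP; apply: contraT; rewrite negb_exists => /forallP allA.
  case/eqP: km; have : #|A| = m.+2; last by rewrite cardA => -[].
  rewrite -[RHS](card_ord m.+2); apply: eq_card => i.
  by have := allA i; rewrite negbK.
have [jm|jm] := ltnP j m.+1; last first.
  apply: last_case cardA; rewrite (_ : ord_max = j)//; apply/val_inj => /=.
  by have := ltn_ord j; lia.
rewrite -(non_polygon_rotate A cmu jm); apply: last_case.
  rewrite inE (_ : shift_ord _ _ = j)//; apply/val_inj => /=.
  by rewrite shift_ordE/=; [case: ifP; lia|lia].
by rewrite card_preimset//; apply: shift_ord_inj; lia.
Qed.

Lemma iid_uniform_cube d (T : measurableType d) (R : realType) (P : probability T R)
    m (X : 'I_m -> {RV P >-> R}) : iid_uniform01 X ->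
  exists mu : probability (m.-tuple R) R, uniform_cube mu /\
    forall E, mu E = P [set w | E [tuple X i w | i < m]].
Proof.
move=> [indX unifX].
have mV : measurable_fun setT (fun w => [tuple X i w | i < m]).
  apply/measurable_fun_tnthP => i; rewrite (_ : _ \o _ = X i)//.
  by apply/funext => w /=; rewrite tnth_mktuple.
have [mu muE] := pushforward_probabilityP P mV.
exists mu; split => // B mB; rewrite muE.
have := indX [set: 'I_m]%SET B (fun i _ => mB i).
rewrite (_ : \bigcap_(i in _) _ = (fun w => [tuple X i w | i < m]) @^-1` box B).
  move=> ->; apply: eq_big => [i|i _]; first by rewrite inE.
  exact: unifX.
apply/seteqP; split => w /= wB i.
  by rewrite tnth_mktuple; apply: wB; rewrite /= inE.
by move=> _; have := wB i; rewrite tnth_mktuple.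
Qed.

(** The hypothesis of independence speaks of the sigma-algebra generated by the
    lengths, so plain measurability of the event would not be enough. *)
Lemma g_sigma_preimage_non_polygon (T : Type) (R : realType) n
    (L : 'I_n -> T -> R) (A : {set 'I_n}) :
  g_sigma_preimage L [set w | ~~ forms_polygon (L^~ w) A].
Proof.
pose V w : n.-tuple R := [tuple L i w | i < n].
have -> : L = (fun i => (@tnth n R)^~ i \o V).
  by apply/funext => i; apply/funext => w /=; rewrite tnth_mktuple.
rewrite g_sigma_preimage_comp.
exists [set t : n.-tuple R | ~~ forms_polygon (tnth t) A].
  apply: (@measurable_non_polygon _ _ R _ (fun i t => tnth t i)) => i.
  exact: measurable_tnth.
by rewrite setTI.
Qed.

Theorem theorem3 (R : realType) (k n : nat) (hk : (3 <= k)%N) (hkn : (k <= n)%N)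
    (d : measure_display) (T : measurableType d) (P : probability T R)
    (X : 'I_n.-1 -> {RV P >-> R}) (S : T -> {set 'I_n})
    (hX : iid_uniform01 X)
    (hS : uniform_ksubset P k S)
    (hSX : independent_of_family P S
             (fun (i : 'I_n) (w : T) => piece (fun j => X j w) i))
    (d' : measure_display) (T' : measurableType d') (P' : probability T' R)
    (Y : 'I_k.-1 -> {RV P' >-> R})
    (hY : iid_uniform01 Y) :
  P [set w : T |
       ~~ forms_polygon (fun i : 'I_n => piece (fun j => X j w) i) (S w)] =
  P' [set w : T' |
       ~~ forms_polygon (fun i : 'I_k => piece (fun j => Y j w) i)
            [set: 'I_k]%SET].
Proof.
case: k n hk hkn X S hX hS hSX Y hY => [|k] [|n]//= _ kn X S hX [mS PS] hSX Y hY.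
have [mu [cmu muE]] := iid_uniform_cube hX.
have [nu [cnu nuE]] := iid_uniform_cube hY.
have tupleE N (D : measure_display) (V : measurableType D) (Q : probability V R)
  (Z : 'I_N -> {RV Q >-> R}) w : (fun j => Z j w) = tnth [tuple Z j w | j < N].
  by apply/funext => j; rewrite tnth_mktuple.
set p := RHS.
have pE : p = nu (non_polygon [set: 'I_k.+1]%SET).
  rewrite nuE; congr (P' _).
  by apply/seteqP; split => w /=; rewrite /non_polygon/= -tupleE.
pose F (A : {set 'I_n.+1}) := [set w |
  ~~ forms_polygon (fun i : 'I_n.+1 => piece (fun j => X j w) i) A].
have mpiece i : measurable_fun setT (fun w => piece (fun j => X j w) (i : 'I_n.+1)).
  under eq_fun do rewrite tupleE.
  apply: (@measurableT_comp _ _ _ _ _ _ (fun t : n.-tuple R => piece (tnth t) i)).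
    by apply: measurable_piece; rewrite -ltnS.
  apply/measurable_fun_tnthP => l; rewrite (_ : _ \o _ = X l)//.
  by apply/funext => w /=; rewrite tnth_mktuple.
have PF (A : {set 'I_n.+1}) : #|A| = k.+1 -> P (F A) = p.
  move=> cardA; rewrite pE -(non_polygon_law cmu cnu cardA) muE.
  by congr (P _); apply/seteqP; split => w /=; rewrite /non_polygon/= -tupleE.
have mF A : measurable (F A).
  exact: (@measurable_non_polygon _ _ R _ (fun i w => piece (fun j => X j w) i)).
have sF A : g_sigma_preimage (fun (i : 'I_n.+1) w => piece (fun j => X j w) i) (F A).
  exact: g_sigma_preimage_non_polygon.
have -> : [set w |
      ~~ forms_polygon (fun i : 'I_n.+1 => piece (fun j => X j w) i) (S w)] =
    \bigcup_(A in [set: {set 'I_n.+1}]) (S @^-1` [set A] `&` F A).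
  apply/seteqP; split => w /=; first by move=> Fw; exists (S w).
  by move=> [A _ [/= <-]].
(* Conditioning on the value of S reduces the claim to a weighted mean of the
   equal numbers P (F A). *)
rewrite measure_bigcup_finType; first last.
- by move=> A B _ _ [w [[/= <- _] [/= <- _]]].
- by move=> A; exact: measurableI.
rewrite (eq_bigr (fun A : {set 'I_n.+1} =>
  if #|A| == k.+1 then (('C(n.+1, k.+1)%:R)^-1%:E * p)%E else 0%E)).
  rewrite -big_mkcond/= sumr_const.
  have -> : #|[pred A : {set 'I_n.+1} | #|A| == k.+1]| = 'C(n.+1, k.+1).
    rewrite -[in RHS](card_ord n.+1) -card_draws.
    by apply: eq_card => A; rewrite !inE.
  transitivity ('C(n.+1, k.+1)%:R%:E * ('C(n.+1, k.+1)%:R^-1%:E * p))%E.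
    by rewrite mule_natl.
  rewrite muleA -EFinM divff ?mul1e//.
  by rewrite pnatr_eq0 -lt0n bin_gt0.
move=> A _; apply: etrans (hSX A (F A) (sF A)) _; rewrite PS.
by case: eqP => [/PF ->|_]; rewrite ?mul0e.
Qed.
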